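(* Let $A \in \mathbb{C}^{m \times n}$ and $\varepsilon, \delta \in (0,1)$. Put $\delta' = \delta/m$ if $A$ is real and $\delta' = \delta/(2m)$ if $A$ is complex. If $R \in \mathbb{R}^{n \times d}$ is a random $(n, d, \delta', \varepsilon)$-JL matrix, then the following holds with probability at least $1-\delta$: $$(1-\varepsilon) \| A \|_F^2 \leq \| A R \|_F^2 \leq (1+\varepsilon) \| A \|_F^2 .$$
   Context: $\|\cdot\|_F$ is the Frobenius norm and $\|\cdot\|$ is the Euclidean norm of a vector. JL sketching operator: a random real matrix $R$ of size $d \times n$, drawn from a distribution $\mathcal{D}$, is an $(n,d,\delta,\varepsilon)$-JL sketching operator (or JL matrix) if for every fixed vector $x \in \mathbb{R}^n$, $$\Pr_{R \sim \mathcal{D}}\left[\left|\|Rx\|^2-\|x\|^2\right| > \varepsilon \|x\|^2\right] < \delta .$$ Since here the operator is applied on the right, the transposed convention is used: a random matrix $R \in \mathbb{R}^{n \times d}$ is called an $(n,d,\delta,\varepsilon)$-JL matrix if the $d \times n$ random matrix $R^T$ satisfies $\Pr\left[\left|\|R^T x\|^2-\|x\|^2\right| > \varepsilon \|x\|^2\right] < \delta$ for every fixed $x \in \mathbb{R}^n$, i.e. if for every fixed $x \in \mathbb{R}^n$, $\Pr\left[\left|\|x^T R\|^2-\|x^T\|^2\right| > \varepsilon \|x^T\|^2\right] < \delta$. *)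

(* Defs.v *)
From mathcomp Require Export all_boot all_order all_algebra.
From mathcomp Require Export all_classical all_reals all_analysis.
From mathcomp Require Export complex.

Set Implicit Arguments.
Unset Strict Implicit.
Unset Printing Implicit Defensive.

Import Order.TTheory GRing.Theory Num.Theory.

Local Open Scope classical_set_scope.
Local Open Scope ring_scope.

(* The library norm `|x| on matrices is the sup norm, hence this definition. *)
Definition euclidean_norm (R : realType) (n : nat) (x : 'cV[R]_n) : R :=
  Num.sqrt (\sum_(i < n) x i 0 ^+ 2).

(* [Normc.normc] is the modulus with values in R; `|z| would live in R[i]. *)
Definition frobenius_norm (R : realType) (m n : nat) (A : 'M[R[i]]_(m, n)) : R :=
  Num.sqrt (\sum_(i < m) \sum_(j < n) Normc.normc (A i j) ^+ 2).

Definition random_matrix (disp : measure_display) (T : measurableType disp)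
    (R : realType) (d n : nat) (S : T -> 'M[R]_(d, n)) : Prop :=
  forall i j, measurable_fun [set: T] (fun t => S t i j).

(* The law of S is the distribution from which the operator is drawn. *)
Definition JL_sketching (disp : measure_display) (T : measurableType disp)
    (R : realType) (P : probability T R) (n d : nat) (delta eps : R)
    (S : T -> 'M[R]_(d, n)) : Prop :=
  random_matrix S /\
  forall x : 'cV[R]_n,
    (P [set t | (eps * euclidean_norm x ^+ 2 <
                 `| euclidean_norm (S t *m x) ^+ 2 - euclidean_norm x ^+ 2 |)%R]
     < delta%:E)%E.

(* Transposed convention, for sketches applied on the right. *)
Definition JL_matrix (disp : measure_display) (T : measurableType disp)
    (R : realType) (P : probability T R) (n d : nat) (delta eps : R)
    (S : T -> 'M[R]_(n, d)) : Prop :=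
  JL_sketching P delta eps (fun t => (S t)^T).

(* The failure probability delta' allotted to each of the m rows (A real), or to
   each of the 2m real and imaginary parts of rows (A not real). *)
Definition row_failure (R : realType) (m n : nat) (A : 'M[R[i]]_(m, n))
    (delta : R) : R :=
  if A \is a mxOver Num.real then delta / m%:R else delta / (2 * m%:R).

(* Main.v *)
Require Import Defs.
From mathcomp Require Import lra measurable_realfun measurable_fun_approximation.

Set Implicit Arguments.
Unset Strict Implicit.
Unset Printing Implicit Defensive.

Import Order.TTheory GRing.Theory Num.Theory.
Local Open Scope classical_set_scope.
Local Open Scope ring_scope.

(** The squared Frobenius norm of a real matrix is the sum of the squared norms of its
    rows, and the rows of [B R] are those of [B] times [R]; so if no row of [B] is
    distorted then neither is the norm of [B], and a union bound over the rows controls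
    the failure probability.  A complex [A] is replaced by the real matrix obtained by
    stacking its real and imaginary parts, which has the same Frobenius norm and [2m]
    rows; since [R] is real, this stacking commutes with right multiplication by [R]. *)

(** Real-valued and free of square roots: it is additive under stacking and polynomial in the
    entries, hence easily seen to be measurable. *)
Definition sqfrobenius (R : realType) (m n : nat) (B : 'M[R]_(m, n)) : R :=
  \sum_(i < m) \sum_(j < n) B i j ^+ 2.

Lemma sqr_euclidean_norm (R : realType) (n : nat) (x : 'cV[R]_n) :
  euclidean_norm x ^+ 2 = \sum_(i < n) x i 0 ^+ 2.
Proof. by rewrite /euclidean_norm sqr_sqrtr // sumr_ge0 // => i _; rewrite sqr_ge0. Qed.

Lemma sqfrobenius_rows (R : realType) (m n : nat) (B : 'M[R]_(m, n)) :
  sqfrobenius B = \sum_(i < m) euclidean_norm (row i B)^T ^+ 2.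
Proof.
apply: eq_bigr => i _; rewrite sqr_euclidean_norm.
by apply: eq_bigr => j _; rewrite !mxE.
Qed.

Lemma sqfrobenius_col_mx (R : realType) (m1 m2 n : nat)
    (B : 'M[R]_(m1, n)) (C : 'M[R]_(m2, n)) :
  sqfrobenius (col_mx B C) = sqfrobenius B + sqfrobenius C.
Proof.
rewrite /sqfrobenius big_split_ord /=; congr (_ + _).
  by apply: eq_bigr => i _; apply: eq_bigr => j _; rewrite col_mxEu.
by apply: eq_bigr => i _; apply: eq_bigr => j _; rewrite col_mxEd.
Qed.

Definition Re_mx (R : realType) (m n : nat) (A : 'M[R[i]]_(m, n)) : 'M[R]_(m, n) :=
  map_mx (@complex.Re R) A.

Definition Im_mx (R : realType) (m n : nat) (A : 'M[R[i]]_(m, n)) : 'M[R]_(m, n) :=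
  map_mx (@complex.Im R) A.

Lemma sqr_frobenius_norm (R : realType) (m n : nat) (A : 'M[R[i]]_(m, n)) :
  frobenius_norm A ^+ 2 = sqfrobenius (Re_mx A) + sqfrobenius (Im_mx A).
Proof.
rewrite /frobenius_norm sqr_sqrtr; last first.
  by apply: sumr_ge0 => i _; apply: sumr_ge0 => j _; rewrite sqr_ge0.
rewrite /sqfrobenius -big_split /=; apply: eq_bigr => i _.
rewrite -big_split /=; apply: eq_bigr => j _; rewrite !mxE.
case: (A i j) => a b /=.
by rewrite sqr_sqrtr // addr_ge0 // sqr_ge0.
Qed.

(** A real factor scales the two parts of [a + bi] separately, so no cross terms arise. *)
Lemma Re_mx_mul_real (R : realType) (m n d : nat) (A : 'M[R[i]]_(m, n))
    (B : 'M[R]_(n, d)) :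
  Re_mx (A *m map_mx (real_complex R) B) = Re_mx A *m B.
Proof.
apply/matrixP => i j; rewrite !mxE raddf_sum /=; apply: eq_bigr => k _.
by rewrite !mxE; case: (A i k) => a b /=; rewrite mulr0 subr0.
Qed.

Lemma Im_mx_mul_real (R : realType) (m n d : nat) (A : 'M[R[i]]_(m, n))
    (B : 'M[R]_(n, d)) :
  Im_mx (A *m map_mx (real_complex R) B) = Im_mx A *m B.
Proof.
apply/matrixP => i j; rewrite !mxE raddf_sum /=; apply: eq_bigr => k _.
by rewrite !mxE; case: (A i k) => a b /=; rewrite mulr0 add0r.
Qed.

Lemma Im_mx_real (R : realType) (m n : nat) (A : 'M[R[i]]_(m, n)) :
  A \is a mxOver Num.real -> Im_mx A = 0.
Proof.
move=> /mxOverP realA; apply/matrixP => i j; rewrite !mxE.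
by have := realA i j; case: (A i j) => a b; rewrite complex_real => /eqP.
Qed.

Lemma sqfrobenius0 (R : realType) (m n : nat) : sqfrobenius (0 : 'M[R]_(m, n)) = 0.
Proof.
by rewrite /sqfrobenius big1 // => i _; rewrite big1 // => j _; rewrite mxE expr0n.
Qed.

Lemma random_matrix_mulmxl (disp : measure_display) (T : measurableType disp)
    (R : realType) (k n d : nat) (B : 'M[R]_(k, n)) (S : T -> 'M[R]_(n, d)) :
  random_matrix S -> random_matrix (fun t => B *m S t).
Proof.
move=> mS i j; under eq_fun do rewrite mxE.
apply: measurable_sum => l; apply: measurable_funM; last exact: mS.
exact: measurable_cst.
Qed.

Lemma measurable_sqfrobenius (disp : measure_display) (T : measurableType disp)
    (R : realType) (n d : nat) (S : T -> 'M[R]_(n, d)) :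
  random_matrix S -> measurable_fun [set: T] (fun t => sqfrobenius (S t)).
Proof.
move=> mS; apply: measurable_sum => i; apply: measurable_sum => j.
exact: measurable_funX.
Qed.

(* [Boole_inequality] only covers families indexed by [nat]. *)
Lemma measure_bigsetU_le (disp : measure_display) (T : measurableType disp)
    (R : realType) (mu : {measure set T -> \bar R}) (I : Type) (r : seq I)
    (F : I -> set T) :
  (forall i, measurable (F i)) ->
  (mu (\big[setU/set0]_(i <- r) F i) <= \sum_(i <- r) mu (F i))%E.
Proof.
move=> mF; elim: r => [|i r IHr]; first by rewrite !big_nil measure0.
rewrite !big_cons; apply: le_trans (leeD2l _ IHr).
by apply: measureU2 => //; apply: bigsetU_measurable.
Qed.

(** The row count [k] is left free so that one union bound serves both cases, [k = m] for real [A]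
    and [k = m + m] for stacked parts; [k%:R * delta' <= delta] is exactly what that bound
    consumes. *)
Lemma JL_sqfrobenius (disp : measure_display) (T : measurableType disp)
    (R : realType) (P : probability T R) (k n d : nat) (B : 'M[R]_(k, n))
    (eps delta delta' : R) (S : T -> 'M[R]_(n, d)) :
  k%:R * delta' <= delta ->
  JL_matrix P delta' eps S ->
  ((1 - delta)%R%:E <=
   P [set t | ((1 - eps) * sqfrobenius B <= sqfrobenius (B *m S t)
              <= (1 + eps) * sqfrobenius B)%R])%E.
Proof.
move=> kdelta [mST JL].
have mS : random_matrix S by move=> i j; have := mST j i; under eq_fun do rewrite mxE.
set good := [set t | _].
(* Sketching acts on columns, so each row of [B] is transposed into a fixed vector [x i]; its sketch
   [y i t] is then a transposed row of [B *m S t]. *)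
pose x i : 'cV[R]_n := (row i B)^T.
pose y i t : 'cV[R]_d := (S t)^T *m x i.
have yE i t : y i t = (row i (B *m S t))^T by rewrite /y /x -trmx_mul row_mul.
have my i : measurable_fun [set: T] (fun t => euclidean_norm (y i t) ^+ 2).
  under eq_fun do rewrite sqr_euclidean_norm.
  apply: measurable_sum => j; apply: measurable_funX.
  under eq_fun do rewrite yE 2!mxE.
  exact: random_matrix_mulmxl.
pose bad i := [set t | eps * euclidean_norm (x i) ^+ 2 <
                 `| euclidean_norm (y i t) ^+ 2 - euclidean_norm (x i) ^+ 2 |].
have mbad i : measurable (bad i).
  (* A strict inequality is the complement of a large one, to which [measurable_fun_le] applies. *)
  rewrite (_ : bad i = ~` ([set: T] `&` [set t |
      `|euclidean_norm (y i t) ^+ 2 - euclidean_norm (x i) ^+ 2|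
      <= eps * euclidean_norm (x i) ^+ 2])); last first.
    by rewrite setTI; apply/seteqP; split=> t; rewrite /bad /= ltNge => /negP.
  apply/measurableC/measurable_fun_le => //.
  by apply: measurableT_comp => //; apply: measurable_funB.
have mgood : measurable good.
  have mSB := measurable_sqfrobenius (random_matrix_mulmxl B mS).
  rewrite (_ : good = [set t | (1 - eps) * sqfrobenius B <= sqfrobenius (B *m S t)] `&`
    [set t | sqfrobenius (B *m S t) <= (1 + eps) * sqfrobenius B]); last first.
    by apply/seteqP; split=> t /andP.
  by apply: measurableI; rewrite -[X in measurable X]setTI; exact: measurable_fun_le.
have subbad : ~` good `<=` \big[setU/set0]_(i < k) bad i.
  move=> t ngood; apply: contrapT => nbad; apply: ngood.
  have rowP i : `|euclidean_norm (y i t) ^+ 2 - euclidean_norm (x i) ^+ 2|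
      <= eps * euclidean_norm (x i) ^+ 2.
    by rewrite leNgt; apply/negP => bi; apply: nbad; rewrite (bigD1 i) //=; left.
  (* Both bounds are linear in the squared row norms, so summing the row estimates keeps the same
     [eps]. *)
  rewrite /good /= !sqfrobenius_rows !mulr_sumr.
  by apply/andP; split; apply: ler_sum => i _; have := rowP i;
    rewrite yE /x ler_norml => /andP[]; lra.
have Pbad : (P (\big[setU/set0]_(i < k) bad i) <= delta%:E)%E.
  apply: (@le_trans _ _ (\sum_(i < k) P (bad i))%E).
    exact: measure_bigsetU_le.
  apply: (@le_trans _ _ (\sum_(i < k) delta'%:E)%E).
    by apply: lee_sum => i _; apply: ltW; exact: JL.
  by rewrite sumEFin lee_fin sumr_const card_ord -mulr_natl.
have PC : (P (~` good) <= delta%:E)%E.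
  apply: le_trans Pbad; apply: le_measure => //; rewrite inE.
    exact: measurableC.
  exact: bigsetU_measurable.
(* As [P good] is finite, [1 - P good <= delta] can be rearranged as an inequality between reals. *)
move: PC; rewrite probability_setC // -(fineK (fin_num_measure P _ mgood)).
by rewrite -EFinB !lee_fin; lra.
Qed.

Theorem theorem1 (R : realType) (m n d : nat) (A : 'M[R[i]]_(m, n))
  (eps delta : R) (disp : measure_display) (T : measurableType disp)
  (P : probability T R) (S : T -> 'M[R]_(n, d)) :
  0 < eps < 1 -> 0 < delta < 1 ->
  JL_matrix P (row_failure A delta) eps S ->
  ((1 - delta)%R%:E <=
   P [set t | ((1 - eps) * frobenius_norm A ^+ 2
              <= frobenius_norm (A *m map_mx (real_complex R) (S t)) ^+ 2
              <= (1 + eps) * frobenius_norm A ^+ 2)%R])%E.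
Proof.
move=> _ /andP[delta0 _].
under eq_set do
  rewrite !sqr_frobenius_norm Re_mx_mul_real Im_mx_mul_real.
(* For [m = 0] only an inequality holds, as [delta / 0 = 0]. *)
have rows_le k : k%:R * (delta / k%:R) <= delta.
  have [->|k0] := eqVneq k 0%N; first by rewrite mul0r ltW.
  by rewrite mulrC divfK // pnatr_eq0.
rewrite /row_failure; case: ifPn => [realA|_] JL.
(* Only the [m] rows of [Re_mx A] remain, matching the allotment [delta / m%:R]. *)
- rewrite (Im_mx_real realA) sqfrobenius0 addr0.
  under eq_set do rewrite mul0mx sqfrobenius0 addr0.
  exact: JL_sqfrobenius JL.
(* The two summands merge into one real matrix with [m + m] rows, matching [delta / (2 * m%:R)]. *)
- under eq_set do rewrite -!sqfrobenius_col_mx -mul_col_mx.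
  apply: JL_sqfrobenius JL.
  by rewrite -natrM mul2n -addnn.
Qed.
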